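(* Let $R$ be a commutative ring, let $k\ge2$, and let $P(x,y)=y-\sum_{i=1}^dA_i(x)\Phi^i(y)$ be an isolating $k$-Mahler equation over $R$ of exponent $d$ and height $h$. Let $f=\sum_{n\ge0}f_nx^n\in R[[x]]$ be a solution of $P(x,f(x))=0$, and let $\mathcal{A}$ be the weighted automaton associated to $P$ and $f_0$. Then for any $w\in\{0,\dots,k-1\}^*$, $$\mathrm{weight}_{\mathcal{A}}(w)=f_{[w]_k}.$$ Consequently, if $R$ is finite, then there exists a deterministic automaton with output with at most $|R|^{\lceil h/(k-1)\rceil d}$ states that generates $f(x)$.
   Context: $k$-Mahler equations: $\Phi(f(x))=f(x^k)$ on $R[[x]]$. An isolating $k$-Mahler equation is $P(x,y)=y-\sum_{i=1}^dA_i(x)\Phi^i(y)=0$ with $A_i(x)=\sum_{j=0}^h\alpha_{i,j}x^j\in R[x]$; $d$ is its exponent and the maximal degree $h$ of the $A_i$ its height. For a word $w$ over $\{0,\dots,k-1\}$ (most significant digit first), $[w]_k$ is the integer it represents in base $k$; $(n)_k$ is the base-$k$ expansion of $n$ without leading zeros. Weighted automaton: $(S,B,\Delta,I,F)$ with $S$ finite, $I,F:S\to R$ and transition weights in $R$ ($s\xrightarrow{b:r}s'$ denotes a transition with label $b$ and weight $r$; unlisted transitions have weight $0$). A path labelled $b_1\cdots b_n$ through $s_0,\dots,s_n$ with weights $r_1,\dots,r_n$ has weight $I(s_0)r_1\cdots r_nF(s_n)$. $\mathrm{weight}_{\mathcal{A}}(w)$ is the sum of the weights of all paths labelled $w$.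 A deterministic automaton with output is $(S,B,\Delta,s_0,\tau)$ with $S$ finite, $\Delta:S\times B\to S$ extended to words, $\tau:S\to R$. It generates $f$ if $f_n=\tau(\Delta(s_0,(n)_k))$ for all $n\ge0$. The weighted automaton associated to $P$ and $f_0\in R$: put $\tilde h=\lceil\frac{h}{k-1}\rceil-1$ and $B=\{0,\dots,k-1\}$. The states are $s_{i,j}$ with $0\le i\le d-1$, $0\le j\le\tilde h$. The transitions are $s_{i,j}\xrightarrow{b:1}s_{i+1,kj+b}$ for $b\in B$, $0\le i\le d-2$, $0\le kj+b\le\tilde h$, and $s_{i,j}\xrightarrow{b:\alpha_{i+1,kj+b-\ell}}s_{0,\ell}$ for $b\in B$, $0\le i\le d-1$, $0\le j,\ell\le\tilde h$, $0\le kj+b-\ell\le h$. Initial weights: $I(s_{i,j})=f_0$ if $j=0$, and $0$ otherwise. Final weights: $F(s_{i,j})=1$ if $i=j=0$, and $0$ otherwise.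
   Formalization: It is additionally assumed that h ≥ 1 or f_0 = 0: for h = 0 and f_0 ≠ 0 (e.g. d = 1, A_1 = 1, f = 1) the automaton has no states, so all weights are 0 ≠ f_0, and one state cannot generate f. *)

(* Defs.v *)
From HB Require Import structures.
From mathcomp Require Import all_boot all_order all_algebra.

Set Implicit Arguments.
Unset Strict Implicit.
Unset Printing Implicit Defensive.

Import GRing.Theory.

Local Open Scope ring_scope.

(* R[[x]]: a power series is its sequence of coefficients. *)
Definition powser (R : Type) := nat -> R.

Section PowerSeries.
Variable R : comNzRingType.

Definition ps_of_poly (p : {poly R}) : powser R := fun n => p`_n.

Definition ps_mul (f g : powser R) : powser R :=
  fun n => \sum_(i < n.+1) f i * g (n - i)%N.

(* f(x) |-> f(x^k) *)
Definition Phi (k : nat) (f : powser R) : powser R :=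
  fun n => if (k %| n)%N then f (n %/ k)%N else 0.

(* An isolating equation of exponent d is given by A_1, ..., A_d; the values
   of A outside 1, ..., d are never used. *)
Definition isolating_mahler (k d : nat) (A : nat -> {poly R})
    (y : powser R) : powser R :=
  fun n => y n -
    \sum_(1 <= i < d.+1) ps_mul (ps_of_poly (A i)) (iter i (Phi k) y) n.

(* The zero polynomial counts as having degree 0. *)
Definition mahler_height (d : nat) (A : nat -> {poly R}) : nat :=
  \max_(1 <= i < d.+1) (size (A i)).-1.

End PowerSeries.

(* Ceiling of m / n, for n > 0. *)
Definition ceildivn (m n : nat) : nat := ((m + n.-1) %/ n)%N.

(* Words have their most significant digit first. *)
Definition word_val (k : nat) (w : seq 'I_k) : nat :=
  foldl (fun (n : nat) (b : 'I_k) => k * n + b)%N 0%N w.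

Fixpoint expansion_rec (k : nat) (k_gt0 : (0 < k)%N) (fuel n : nat) :
    seq 'I_k :=
  if fuel is m.+1 then
    if n == 0%N then [::]
    else rcons (expansion_rec k_gt0 m (n %/ k)) (Ordinal (ltn_pmod n k_gt0))
  else [::].

(* The expansion of n without leading zeros; in particular that of 0 is the
   empty word. For k > 1, n steps of fuel are always enough. *)
Definition expansion (k : nat) (k_gt1 : (1 < k)%N) (n : nat) : seq 'I_k :=
  expansion_rec (ltnW k_gt1) n n.

Lemma word_val_rcons (k : nat) (w : seq 'I_k) (b : 'I_k) :
  word_val (rcons w b) = (k * word_val w + b)%N.
Proof. by rewrite /word_val foldl_rcons. Qed.

Lemma expansion_recK (k : nat) (k_gt1 : (1 < k)%N) (m n : nat) :
  (n <= m)%N -> word_val (expansion_rec (ltnW k_gt1) m n) = n.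
Proof.
elim: m n => [|m IHm] n /=; first by rewrite leqn0 => /eqP->.
case: eqP => [->|/eqP n0] // le_nm; rewrite word_val_rcons IHm /=.
  by rewrite mulnC -divn_eq.
by rewrite -ltnS (leq_trans _ le_nm) // ltn_Pdiv // lt0n.
Qed.

Lemma expansionK (k : nat) (k_gt1 : (1 < k)%N) (n : nat) :
  word_val (expansion k_gt1 n) = n.
Proof. exact: expansion_recK. Qed.

Lemma expansion_no_leading0 (k : nat) (k_gt1 : (1 < k)%N) (n : nat)
    (b : 'I_k) (w : seq 'I_k) :
  expansion k_gt1 n = b :: w -> b != 0%N :> nat.
Proof.
rewrite /expansion; move: {2 3}n (leqnn n) => m.
elim: m n w => [|m IHm] n w //= le_nm.
case: eqP => [//|/eqP n0].
have le_qm : (n %/ k <= m)%N.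
  by rewrite -ltnS (leq_trans _ le_nm) // ltn_Pdiv // lt0n.
have := expansion_recK k_gt1 le_qm; have := fun w => IHm _ w le_qm.
case: expansion_rec => [|c u] IH /=.
  move=> q0 [<- _] /=; apply: contra n0 => /eqP r0.
  by rewrite (divn_eq n k) r0 -q0.
by move=> _ [cb _]; apply: (IH u); rewrite cb.
Qed.

Record wautomaton (B : finType) (R : Type) := WAutomaton {
  wa_state : finType;
  wa_trans : wa_state -> B -> wa_state -> R;
  wa_init : wa_state -> R;
  wa_final : wa_state -> R
}.

Section Weight.
Variables (B : finType) (R : comNzRingType) (M : wautomaton B R).

Definition path_weight (w : seq B) (p : {ffun 'I_(size w).+1 -> wa_state M}) :
    R :=
  wa_init (p ord0) *
  (\prod_(t < size w)
     wa_trans (p (inord t)) (tnth (in_tuple w) t) (p (inord t.+1))) *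
  wa_final (p ord_max).

Definition weight (w : seq B) : R :=
  \sum_(p : {ffun 'I_(size w).+1 -> wa_state M}) path_weight p.

End Weight.

Record dfao (B : finType) (R : Type) := Dfao {
  dfao_state : finType;
  dfao_trans : dfao_state -> B -> dfao_state;
  dfao_init : dfao_state;
  dfao_out : dfao_state -> R
}.

Definition generates (k : nat) (k_gt1 : (1 < k)%N) (R : Type)
    (M : dfao 'I_k R) (f : powser R) : Prop :=
  forall n : nat,
    f n = dfao_out (foldl (@dfao_trans _ _ M) (dfao_init M)
                          (expansion k_gt1 n)).

(* With h the height, the state (i, j) is s_{i,j}. The bound
   j <= ceil (h / (k - 1)) - 1 is written j < ceil (h / (k - 1)), so that the
   automaton has no state when h = 0. The two families of transitions have
   disjoint targets, since i + 1 <> 0. *)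
Section MahlerAutomaton.
Variables (R : comNzRingType) (k d : nat) (A : nat -> {poly R}) (f0 : R).

Let h := mahler_height d A.
Let state : finType := ('I_d * 'I_(ceildivn h (k - 1)%N))%type.

Definition mahler_trans (s : state) (b : 'I_k) (s' : state) : R :=
  let: (i, j) := s in let: (i', l) := s' in
  let c := (k * j + b)%N in
  if (i' == i.+1 :> nat) && (l == c :> nat) then 1
  else if [&& i' == 0%N :> nat, (l <= c)%N & (c - l <= h)%N]
    then (A i.+1)`_(c - l)%N
  else 0.

Definition mahler_wautomaton : wautomaton 'I_k R :=
  {| wa_state := state;
     wa_trans := mahler_trans;
     wa_init := fun s => if s.2 == 0%N :> nat then f0 else 0;
     wa_final := fun s =>
       if (s.1 == 0%N :> nat) && (s.2 == 0%N :> nat) then 1 else 0 |}.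

End MahlerAutomaton.

(* Main.v *)
(** Write [H] for the ceiling of [h / (k - 1)]. After a word of value [n] has
    been read, the total weight of the paths that end in [s_{i,j}] is the
    coefficient of [x^n] in [x^j Phi^i(f)]; at [s_{0,0}] this is [f_n]. This is
    an induction on the word: appending [b] replaces [n] by [k n + b], and in
    [x^l f = sum_i A_i x^l Phi^i(f)] only the exponents [kj + b] of [A_i x^l]
    contribute to the coefficient of [x^(kn+b)]. Because [l < H] and
    [h + H <= k H], such [j] satisfy [j < H]. Over a finite ring, the vectors of
    total weights are the states of a deterministic automaton. *)

Require Import Defs.
From HB Require Import structures.
From mathcomp Require Import all_boot all_order all_algebra.
From mathcomp Require Import zify.

Set Implicit Arguments.
Unset Strict Implicit.
Unset Printing Implicit Defensive.

Import GRing.Theory.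

Local Open Scope ring_scope.

(** * Propagation of weight vectors along a word *)

Section ForwardWeights.
Variables (B : finType) (R : comNzRingType).

Definition forward_step (S : finType) (T : S -> B -> S -> R) (V : S -> R)
    (b : B) : S -> R :=
  fun s' => \sum_s V s * T s b s'.

(** A path is its first state together with the remaining path ([glue] and [cut]). Summing over the
    first state absorbs the first transition into new initial weights. *)
Lemma weight_cons (S : finType) (T : S -> B -> S -> R) (I F : S -> R)
    (b : B) (w : seq B) :
  weight (WAutomaton T I F) (b :: w) =
  weight (WAutomaton T (forward_step T I b) F) w.
Proof.
pose glue (q : S * {ffun 'I_(size w).+1 -> S}) : {ffun 'I_(size w).+2 -> S} :=
  [ffun t => if unlift ord0 t is Some u then q.2 u else q.1].
pose cut (p : {ffun 'I_(size w).+2 -> S}) :=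
  (p ord0, [ffun u : 'I_(size w).+1 => p (lift ord0 u)]).
have glue0 q : glue q ord0 = q.1 by rewrite ffunE unlift_none.
have glueS q u : glue q (lift ord0 u) = q.2 u by rewrite ffunE liftK.
have glueK : cancel glue cut.
  case=> s p; rewrite /cut glue0; congr (_, _).
  by apply/ffunP=> u; rewrite ffunE glueS.
have cutK : cancel cut glue.
  move=> p; apply/ffunP=> t; rewrite ffunE.
  by case: unliftP => [u ->|->] //=; rewrite ffunE.
have inordS (t : nat) : (t < (size w).+1)%N ->
    inord t.+1 = lift ord0 (inord t) :> 'I_(size w).+2.
  by move=> lt_t; apply: val_inj; rewrite /= !inordK.
rewrite /weight (reindex glue) /=; last by exists cut => ? _.
rewrite -(pair_bigA _ 
  (fun s p => @path_weight _ _ (WAutomaton T I F) (b :: w) (glue (s, p)))) exchange_big /=.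
apply: eq_bigr => p _; rewrite /path_weight /= /forward_step !mulr_suml.
apply: eq_bigr => s _; rewrite big_ord_recl.
have in0 : inord 0 = ord0 :> 'I_(size w).+2 by apply: val_inj; rewrite /= inordK.
have in0' : inord 0 = ord0 :> 'I_(size w).+1 by apply: val_inj; rewrite /= inordK.
have maxE : ord_max = lift ord0 ord_max :> 'I_(size w).+2 by apply: val_inj.
rewrite /= in0 inordS // in0' glue0 maxE !glueS /= !mulrA; congr (_ * _ * _).
apply: eq_bigr => t _.
rewrite /bump /= !add1n !inordS ?glueS ?(tnth_nth b) //;
  by have := ltn_ord t; lia.
Qed.

Lemma weight_forward (S : finType) (T : S -> B -> S -> R) (I F : S -> R)
    (w : seq B) :
  weight (WAutomaton T I F) w = \sum_s foldl (forward_step T) I w s * F s.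
Proof.
elim: w I => [|b w IHw] I; last by rewrite weight_cons IHw.
rewrite /weight (reindex (fun s : S => [ffun _ : 'I_1 => s])) /=.
  by apply: eq_bigr => s _; rewrite /path_weight /= big_ord0 !ffunE mulr1.
exists (fun p : {ffun 'I_1 -> S} => p ord0) => [s|p] _; first by rewrite ffunE.
by apply/ffunP=> t; rewrite ffunE [t]ord1.
Qed.

(** Reading a letter acts on weight vectors by a function, so the vectors themselves can serve as
    states. Entries are stored as indices into [e], which makes the state set a finite type of the
    stated size. *)
Lemma weight_dfao (M : wautomaton B R) (e : seq R) : Finite.axiom e ->
  exists D : dfao B R,
    #|dfao_state D| = (size e ^ #|wa_state M|)%N /\
    forall w, weight M w =
      dfao_out (foldl (@dfao_trans _ _ D) (dfao_init D) w).
Proof.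
case: M => S T I F /= e_fin.
have mem_e r : r \in e by rewrite -has_pred1 has_count e_fin.
have lt_e r : (index r e < size e)%N by rewrite index_mem.
pose enc (V : S -> R) : {ffun S -> 'I_(size e)} := [ffun s => Ordinal (lt_e (V s))].
pose dec (v : {ffun S -> 'I_(size e)}) s := e`_(v s).
have encK V s : dec (enc V) s = V s by rewrite /dec ffunE nth_index.
exists {| dfao_trans := fun v b => enc (forward_step T (dec v) b);
          dfao_init := enc I;
          dfao_out := fun v => \sum_s dec v s * F s |}.
split=> [|w] /=; first by rewrite card_ffun card_ord.
rewrite weight_forward; apply: eq_bigr => s _; congr (_ * _).
elim/last_ind: w s => [|w b IHw] s; first by rewrite encK.
rewrite !foldl_rcons encK.
by apply: eq_bigr => s' _; rewrite IHw.
Qed.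

End ForwardWeights.

(** * Coefficients of shifted series, products and images of [Phi] *)

Section Coefficients.
Variable R : comNzRingType.

(* The coefficient of [x^n] in [x^j g]. *)
Definition shift_coef (g : powser R) (j n : nat) : R :=
  if (j <= n)%N then g (n - j)%N else 0.

Lemma shift_coef_Phi (k : nat) (g : powser R) (j b n : nat) : (0 < k)%N ->
  shift_coef (Phi k g) (k * j + b) (k * n + b) = shift_coef g j n.
Proof.
move=> k_gt0; rewrite /shift_coef leq_add2r leq_pmul2l // subnDr -mulnBr /Phi.
by rewrite dvdn_mulr // mulKn.
Qed.

(** All exponents of x^c g(x^k) are congruent to c modulo k and at least c. If kn + b = c + qk, then
    q <= n because b < k, so c = k(n - q) + b, which is excluded. *)
Lemma shift_coef_Phi0 (k : nat) (g : powser R) (c b n : nat) : (b < k)%N ->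
    (forall j, (k * j + b)%N != c) ->
  shift_coef (Phi k g) c (k * n + b) = 0.
Proof.
move=> lt_bk ne_c; rewrite /shift_coef /Phi; case: leqP => // le_c.
case: dvdnP => // -[q Eq]; have := ne_c (n - q)%N.
have le_q : (q <= n)%N by nia.
by rewrite mulnBr; nia.
Qed.

Lemma shift_coef_mul (a g : powser R) (l n m : nat) : (n < m)%N ->
  shift_coef (ps_mul a g) l n =
  \sum_(c < m) shift_coef a l c * shift_coef g c n.
Proof.
move=> lt_nm; rewrite {1}/shift_coef; case: (leqP l n) => [le_ln|lt_nl]; last first.
  rewrite big1 // => c _; rewrite /shift_coef.
  case: (leqP l c) => [le_lc|_]; last by rewrite mul0r.
  by rewrite [(c <= n)%N]leqNgt (leq_trans lt_nl le_lc) mulr0.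
rewrite -(big_mkord xpredT (fun c => shift_coef a l c * shift_coef g c n)).
rewrite (big_cat_nat (n := l)) //=; last by lia.
rewrite [X in X + _]big_nat_cond big1 ?add0r => [|c /andP[/andP[_ lt_cl] _]]; last first.
  by rewrite /shift_coef leqNgt lt_cl mul0r.
rewrite (big_cat_nat (n := n.+1)) //=; last by lia.
rewrite [X in _ + X]big_nat_cond [X in _ + X]big1 ?addr0 => [|c /andP[/andP[lt_nc _] _]]; last first.
  by rewrite /shift_coef [(c <= n)%N]leqNgt lt_nc mulr0.
rewrite -{2}[l]add0n big_addn big_mkord subSn //; apply: eq_bigr => t _.
have le_t : (t + l <= n)%N by have := ltn_ord t; lia.
by rewrite /shift_coef leq_addl le_t addnK addnC subnDA.
Qed.

(** In x^l a(x) g(x^k), a term x^c of x^l a can contribute to x^(kn+b) only if c has residue b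
    modulo k, that is, c = kj + b. *)
Lemma shift_coef_mul_Phi (k : nat) (a g : powser R) (l b n m : nat) :
    (b < k)%N ->
    (forall j, (m <= j)%N -> shift_coef a l (k * j + b) = 0) ->
  shift_coef (ps_mul a (Phi k g)) l (k * n + b) =
  \sum_(j < m) shift_coef a l (k * j + b) * shift_coef g j n.
Proof.
move=> lt_bk a0.
(* This bound is a multiple of k, so the range splits into blocks of length k with one surviving
   term each. It exceeds kn + b, and the blocks include all j < m. *)
rewrite (@shift_coef_mul _ _ _ _ ((m + n.+1) * k)); last by nia.
rewrite -(big_mkord xpredT (fun c =>
  shift_coef a l c * shift_coef (Phi k g) c (k * n + b))).
rewrite big_nat_mul big_mkord (big_ord_widen _ (fun j =>
  shift_coef a l (k * j + b) * shift_coef g j n) (leq_addr n.+1 m)) [RHS]big_mkcond.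
apply: eq_bigr => j _; rewrite -{1}[(j * k)%N]add0n big_addn mulSn addnK big_mkord.
rewrite (bigD1 (Ordinal lt_bk)) //= big1 => [|r ne_rb].
  rewrite addr0 [(b + _)%N]addnC [(j * k)%N]mulnC shift_coef_Phi; last by lia.
  by case: ltnP => // /a0 ->; rewrite mul0r.
rewrite (@shift_coef_Phi0 k) ?mulr0 // => i; apply: contra ne_rb => /eqP Ec.
apply/eqP/val_inj; move/(congr1 (modn^~ k)): Ec.
by rewrite [(k * i)%N]mulnC [(r + _)%N]addnC !modnMDl !modn_small.
Qed.

End Coefficients.

(** * Weight vectors of the Mahler automaton *)

Section MahlerWeights.
Variables (R : comNzRingType) (k d : nat) (A : nat -> {poly R}).
Hypothesis k_gt1 : (1 < k)%N.
Let h := mahler_height d A.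
Let H := ceildivn h (k - 1).

Lemma mahler_solutionE (f : powser R) :
    (forall n, isolating_mahler k d A f n = 0) ->
  forall n, f n =
    \sum_(i < d) ps_mul (ps_of_poly (A i.+1)) (Phi k (iter i (Phi k) f)) n.
Proof.
move=> f_sol n; apply/eqP; rewrite -subr_eq0 -{2}(f_sol n) /isolating_mahler.
by rewrite big_add1 big_mkord.
Qed.

Lemma coef_mahler_height (i t : nat) : (i < d)%N -> (h < t)%N ->
  (A i.+1)`_t = 0.
Proof.
move=> lt_id lt_ht; apply: nth_default.
have : ((size (A i.+1)).-1 <= h)%N.
  by apply: (@leq_bigmax_seq _ _ xpredT (fun i => (size (A i)).-1)); rewrite ?mem_index_iota.
by move/leq_ltn_trans/(_ lt_ht); case: (size _).
Qed.

Lemma mahler_height_ceildivn : (h + H <= k * H)%N.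
Proof.
have k1_gt0 : (0 < k - 1)%N by lia.
have /leq_trans -> // : (h + H <= (k - 1) * H + H)%N; last by nia.
rewrite leq_add2r /H /ceildivn mulnC.
have := ltn_pmod (h + (k - 1).-1) k1_gt0; have := divn_eq (h + (k - 1).-1) (k - 1).
lia.
Qed.

Lemma mahler_forward (f : powser R) :
    (forall n, isolating_mahler k d A f n = 0) ->
  let M := mahler_wautomaton k d A (f 0%N) in
  forall (w : seq 'I_k) (s : wa_state M),
    foldl (forward_step (@wa_trans _ _ M)) (@wa_init _ _ M) w s =
    shift_coef (iter s.1 (Phi k) f) s.2 (word_val w).
Proof.
move=> f_sol M; elim/last_ind=> [|w b IHw] [[i' lt_i'] l] /=.
  (* [Phi] keeps the constant coefficient, so that of x^j Phi^i(f) is f_0 for j = 0, and it is 0 for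
     j > 0. *)
  rewrite /shift_coef /= leqn0; case: eqP => // ->.
  by elim: i' {lt_i'} => [|i IHi] //=; rewrite /Phi dvdn0 div0n.
rewrite foldl_rcons word_val_rcons; set n := word_val w in IHw *.
have lt_lH : (l < H)%N := ltn_ord l.
transitivity (\sum_(i < d) \sum_(j < H)
  shift_coef (iter i (Phi k) f) j n * wa_trans (w := M) (i, j) b (Ordinal lt_i', l)).
  by rewrite pair_bigA; apply: eq_bigr => -[i j] _; rewrite IHw.
rewrite /=.
(* In a row i0 + 1 > 0, only transitions of weight 1 from row i0 arrive, from the at most one j with
   kj + b = l. *)
case: i' lt_i' => [|i0] lt_i' /=; last first.
  pose i1 : 'I_d := Ordinal (ltnW lt_i').
  rewrite (bigD1 i1) //= [X in _ + X]big1 ?addr0 => [|i ne_i]; last first.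
    apply: big1 => j _; rewrite eqSS eq_sym; move: ne_i.
    by rewrite -val_eqE /= => /negPf ->; rewrite mulr0.
  under eq_bigr do rewrite eqxx /=.
  case: (boolP [exists j : 'I_H, (k * j + b)%N == l]) => [/existsP[j0 /eqP Ej0]|].
    rewrite (bigD1 j0) //= Ej0 eqxx mulr1 big1 ?addr0 => [|j ne_j].
      by rewrite -Ej0 shift_coef_Phi // ltnW.
    case: eqP => [El|_]; last by rewrite mulr0.
    case/eqP: ne_j; apply: val_inj; apply/eqP.
    by rewrite -(eqn_pmul2l (ltnW k_gt1)) -(eqn_add2r b) Ej0 El.
  move=> /existsPn noj; rewrite big1 => [|j _].
    rewrite shift_coef_Phi0 // => j; apply/negP => /eqP Ej.
    (* The bound on the states loses no such j, since j <= kj + b = l < H. *)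
    have lt_jH : (j < H)%N by have := leq_pmull j (ltnW k_gt1); lia.
    by have /eqP := noj (Ordinal lt_jH).
  by rewrite eq_sym (negPf (noj j)) mulr0.
transitivity (\sum_(i < d) shift_coef
  (ps_mul (ps_of_poly (A i.+1)) (Phi k (iter i (Phi k) f))) l (k * n + b)).
  apply: eq_bigr => i _; rewrite (@shift_coef_mul_Phi _ _ _ _ _ _ _ H) //.
    apply: eq_bigr => j _; rewrite mulrC; congr (_ * _).
    rewrite /shift_coef /ps_of_poly; case: leqP => //= _.
    (* Beyond degree h the transition weight is 0 by its guard, and the coefficient is 0 because h
       bounds the degrees. *)
    by case: leqP => // /coef_mahler_height ->.
  move=> j le_Hj; rewrite /shift_coef; case: leqP => // le_lj.
  apply: coef_mahler_height => //.
  (* For j >= H, kj + b >= kH >= h + H > h + l, so the coefficient index exceeds h. *)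
  have := mahler_height_ceildivn; nia.
rewrite {2}/shift_coef; case: leqP => [le_l|gt_l].
  by rewrite [RHS]mahler_solutionE //; apply: eq_bigr => i _; rewrite /shift_coef le_l.
by apply: big1 => i _; rewrite /shift_coef leqNgt gt_l.
Qed.

(** At height 0 the automaton has no state and every weight is 0, so f must vanish. The A_i are
    constants, and for n > 0 the coefficient of x^n in Phi^i(f), i >= 1, is 0 or a coefficient of f
    of smaller index. *)
Lemma height0_solution (f : powser R) :
    (forall n, isolating_mahler k d A f n = 0) ->
  h = 0%N -> f 0%N = 0 -> forall n, f n = 0.
Proof.
move=> f_sol h0 f0; elim/ltn_ind=> n IHn.
have iter0 i m : (m < n)%N -> iter i (Phi k) f m = 0.
  elim: i m => [|i IHi] m lt_mn /=; first exact: IHn.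
  rewrite /Phi; case: ifP => // _; apply: IHi.
  exact: leq_ltn_trans (leq_div _ _) lt_mn.
case: (posnP n) => [->//|n_gt0].
rewrite mahler_solutionE // big1 // => i _; rewrite /ps_mul big1 // => t _.
rewrite /ps_of_poly; case: (posnP t) => [->|t_gt0]; last first.
  by rewrite coef_mahler_height ?mul0r // h0.
rewrite subn0 /Phi; case: ifP => _; last by rewrite mulr0.
by rewrite iter0 ?mulr0 // ltn_Pdiv.
Qed.

End MahlerWeights.

(** The hypothesis [nondegenerate] excludes cases such as y = Phi(y) with f = 1, where the automaton
    is empty but f_0 = 1. [Finite.axiom e] says that [e] lists each element of R exactly once, so
    [size e] is the cardinality of R. *)
Theorem theorem14 (R : comNzRingType) (k d : nat) (k_gt1 : (1 < k)%N)
    (A : nat -> {poly R}) (f : powser R)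
    (f_sol : forall n : nat, isolating_mahler k d A f n = 0)
    (nondegenerate : (0 < mahler_height d A)%N \/ f 0%N = 0) :
  (forall w : seq 'I_k,
     weight (mahler_wautomaton k d A (f 0%N)) w = f (word_val w)) /\
  (forall e : seq R, Finite.axiom e ->
     exists M : dfao 'I_k R,
       (#|dfao_state M|
          <= size e ^ (ceildivn (mahler_height d A) (k - 1) * d))%N /\
       generates k_gt1 M f).
Proof.
have weight_f w : weight (mahler_wautomaton k d A (f 0%N)) w = f (word_val w).
  rewrite weight_forward.
  under eq_bigr do rewrite (mahler_forward k_gt1 f_sol).
  case: (posnP (mahler_height d A)) => [h0|h_gt0].
    have f0 : f 0%N = 0 by case: nondegenerate => //; rewrite h0.
    rewrite (height0_solution k_gt1 f_sol h0 f0) big1 // => -[i [j lt_j]] _.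
    by exfalso; move: lt_j; rewrite h0 /ceildivn divn_small //; lia.
  (* Positive height makes both d and H positive, so the only final state s_{0,0} exists. *)
  have d_gt0 : (0 < d)%N.
    by case: (posnP d) h_gt0 => // ->; rewrite /mahler_height big_geq.
  have H_gt0 : (0 < ceildivn (mahler_height d A) (k - 1))%N.
    by rewrite /ceildivn divn_gt0; lia.
  rewrite (bigD1 (Ordinal d_gt0, Ordinal H_gt0)) //= mulr1 big1 ?addr0.
    by rewrite /shift_coef subn0.
  case=> i j ne_ij /=; case: ifP => [/andP[/eqP i0 /eqP j0]|_]; last exact: mulr0.
  by case/eqP: ne_ij; congr (_, _); apply: val_inj.
split=> // e e_fin.
have [M [cardM weightM]] := weight_dfao (mahler_wautomaton k d A (f 0%N)) e_fin.
exists M; split; last by move=> n; rewrite -weightM weight_f expansionK.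
by rewrite cardM /= card_prod !card_ord mulnC.
Qed.
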